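(* Let $\mathcal C$ be a braided closed monoidal category that is (ExtrEpi, Mono)-structured. Let $A$ be an $\Omega$-magma in $\mathcal C$ and let $i\colon V\to[A,A]$ be a submonoid such that the $V$-universal measuring comonoid ${}_\square\mathcal C(A,A,V)$, with universal measuring $\psi_{A,V}\colon{}_\square\mathcal C(A,A,V)\otimes A\to A$, exists. Then ${}_\square\mathcal B(A,V):={}_\square\mathcal C(A,A,V)$ admits a structure of a bimonoid such that for any bimonoid $B$ and any action $\psi\colon B\otimes A\to A$ such that $\operatorname{cosupp}\psi$ is a submonoid of $V$, the unique comonoid homomorphism $\varphi\colon B\to{}_\square\mathcal B(A,V)$ with $\psi_{A,V}(\varphi\otimes \mathrm{id}_A)=\psi$ is in fact a bimonoid homomorphism. In other words, ${}_\square\mathcal B(A,V)$ is the $V$-universal acting bimonoid on $A$.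
   Context: Associativity and unit constraints are suppressed; $c$ is the braiding and $\mathbf 1$ the monoidal unit. $\Omega$ is a fixed set with maps $s,t\colon\Omega\to\mathbb Z_{\geq 0}$. An $\Omega$-magma in $\mathcal C$ is an object $A$ with morphisms $\omega_A\colon A^{\otimes s(\omega)}\to A^{\otimes t(\omega)}$ for all $\omega\in\Omega$ ($A^{\otimes 0}=\mathbf 1$; no identities are required). For a comonoid $(P,\Delta,\varepsilon)$ and $\psi_i\colon P\otimes A_i\to B_i$, put $\psi_1\tilde\otimes\psi_2=(\psi_1\otimes\psi_2)(\mathrm{id}_P\otimes c_{P,A_1}\otimes \mathrm{id}_{A_2})(\Delta\otimes \mathrm{id}_{A_1\otimes A_2})$; $\psi^{\tilde\otimes n}$ is the iterated product, $\psi^{\tilde\otimes 0}$ is $P\otimes\mathbf 1\cong P\xrightarrow{\varepsilon}\mathbf 1$. A measuring from $A$ to $B$ is a morphism $\psi\colon P\otimes A\to B$, $P$ a comonoid, with $\omega_B\,\psi^{\tilde\otimes s(\omega)}=\psi^{\tilde\otimes t(\omega)}(\mathrm{id}_P\otimes\omega_A)$ for all $\omega\in\Omega$. For a bimonoid $P$, an action of $P$ on $A$ is a measuring $P\otimes A\to A$ that is a left $P$-module structure. Closed means that each $(-)\otimes A$ has a right adjoint $[A,-]$ with counit $\mathrm{ev}_{A,B}\colon[A,B]\otimes A\to B$. For $\psi\colon P\otimes A\to B$, $K\psi\colon P\to[A,B]$ is the morphism with $\mathrm{ev}_{A,B}(K\psi\otimes \mathrm{id}_A)=\psi$. $[A,A]$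 is a monoid in the unique way making $\mathrm{ev}_{A,A}$ a left module structure on $A$; for a monoid $P$, $\psi\colon P\otimes A\to A$ is a module structure iff $K\psi$ is a monoid homomorphism. A submonoid $i\colon V\to[A,A]$ is a monoid homomorphism that is a monomorphism in $\mathcal C$. (ExtrEpi, Mono)-structured: every morphism factors as an extremal epimorphism followed by a monomorphism, and the unique diagonalization property holds for these two classes. $\operatorname{cosupp}\psi\rightarrowtail[A,A]$ is the image of $K\psi$, i.e. the monomorphism in this factorization of $K\psi$; the condition that $\operatorname{cosupp}\psi$ is contained in $V$ is equivalent to $K\psi$ factoring through $i$. $V$-universal measuring comonoid: $\psi_{A,V}:=\psi_{A,A,V}\colon{}_\square\mathcal C(A,A,V)\otimes A\to A$ is the terminal object in the category of measurings $\psi\colon P\otimes A\to A$ ($P$ any comonoid) such that $K\psi$ factors through $i$, morphisms $\psi_1\to\psi_2$ being comonoid homomorphisms $\varphi\colon P_1\to P_2$ with $\psi_2(\varphi\otimes \mathrm{id}_A)=\psi_1$. $V$-universal acting bimonoid: the bimonoid of the terminal object in the category of actions $\psi\colon B\otimes A\to A$ ($B$ any bimonoid) such that $K\psi$ factors through $i$, morphisms being bimonoid homomorphisms compatible with the actions in the same way. *)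

(* Defs.v *)
From Corelib Require Import ssreflect ssrfun ssrbool.

Set Implicit Arguments.
Unset Strict Implicit.
Unset Printing Implicit Defensive.

Declare Scope cat_scope.
Delimit Scope cat_scope with cat.
Local Open Scope cat_scope.

Record Category : Type := MkCategory {
  Ob :> Type;
  Hom : Ob -> Ob -> Type;
  idm : forall X, Hom X X;
  comp : forall X Y Z, Hom Y Z -> Hom X Y -> Hom X Z;
  comp1m : forall X Y (f : Hom X Y), comp (idm Y) f = f;
  compm1 : forall X Y (f : Hom X Y), comp f (idm X) = f;
  compA : forall X Y Z W (h : Hom Z W) (g : Hom Y Z) (f : Hom X Y),
    comp h (comp g f) = comp (comp h g) f
}.

Arguments Hom {c} X Y.
Arguments idm {c X}.
Notation "g ∘ f" := (comp g f) (at level 40, left associativity) : cat_scope.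

Section Morphisms.
Variable C : Category.

Definition is_iso (X Y : C) (f : Hom X Y) : Prop :=
  exists g : Hom Y X, g ∘ f = idm /\ f ∘ g = idm.

Definition is_mono (X Y : C) (m : Hom X Y) : Prop :=
  forall (Z : C) (f g : Hom Z X), m ∘ f = m ∘ g -> f = g.

Definition is_epi (X Y : C) (e : Hom X Y) : Prop :=
  forall (Z : C) (f g : Hom Y Z), f ∘ e = g ∘ e -> f = g.

Definition is_extremal_epi (X Y : C) (e : Hom X Y) : Prop :=
  is_epi e /\
  forall (Z : C) (m : Hom Z Y) (g : Hom X Z),
    is_mono m -> e = m ∘ g -> is_iso m.

Definition factors_through (X Y Z : C) (f : Hom X Y) (i : Hom Z Y) : Prop :=
  exists g : Hom X Z, f = i ∘ g.

(* [m] is an image of [f], i.e. the mono part of an (ExtrEpi, Mono)-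
   factorization; in a structured category it is unique up to isomorphism. *)
Definition is_image (X Y I : C) (f : Hom X Y) (m : Hom I Y) : Prop :=
  is_mono m /\ exists e : Hom X I, is_extremal_epi e /\ f = m ∘ e.

End Morphisms.

Record ExtrEpiMono_structured (C : Category) : Prop := {
  structured_factorization : forall (X Y : C) (f : Hom X Y),
    exists (I : C) (e : Hom X I) (m : Hom I Y),
      is_extremal_epi e /\ is_mono m /\ f = m ∘ e;
  structured_diagonal : forall (X Y Z W : C)
    (e : Hom X Y) (m : Hom Z W) (u : Hom X Z) (v : Hom Y W),
    is_extremal_epi e -> is_mono m -> m ∘ u = v ∘ e ->
    exists! d : Hom Y Z, d ∘ e = u /\ m ∘ d = v
}.

Record MonoidalCategory : Type := MkMonoidal {
  mcat :> Category;
  tens : mcat -> mcat -> mcat;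
  tensm : forall X Y X' Y' : mcat,
    Hom X X' -> Hom Y Y' -> Hom (tens X Y) (tens X' Y');
  munit : mcat;
  assoc : forall X Y Z : mcat, Hom (tens (tens X Y) Z) (tens X (tens Y Z));
  associ : forall X Y Z : mcat, Hom (tens X (tens Y Z)) (tens (tens X Y) Z);
  lunit : forall X : mcat, Hom (tens munit X) X;
  luniti : forall X : mcat, Hom X (tens munit X);
  runit : forall X : mcat, Hom (tens X munit) X;
  runiti : forall X : mcat, Hom X (tens X munit);
  tensm1 : forall X Y : mcat, tensm (@idm _ X) (@idm _ Y) = idm;
  tensm_comp : forall (X Y Z X' Y' Z' : mcat)
    (g : Hom Y Z) (f : Hom X Y) (g' : Hom Y' Z') (f' : Hom X' Y'),
    tensm (g ∘ f) (g' ∘ f') = tensm g g' ∘ tensm f f';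
  assocK : forall X Y Z : mcat, associ X Y Z ∘ assoc X Y Z = idm;
  associK : forall X Y Z : mcat, assoc X Y Z ∘ associ X Y Z = idm;
  lunitK : forall X : mcat, luniti X ∘ lunit X = idm;
  lunitiK : forall X : mcat, lunit X ∘ luniti X = idm;
  runitK : forall X : mcat, runiti X ∘ runit X = idm;
  runitiK : forall X : mcat, runit X ∘ runiti X = idm;
  assoc_nat : forall (X Y Z X' Y' Z' : mcat)
    (f : Hom X X') (g : Hom Y Y') (h : Hom Z Z'),
    assoc X' Y' Z' ∘ tensm (tensm f g) h = tensm f (tensm g h) ∘ assoc X Y Z;
  lunit_nat : forall (X Y : mcat) (f : Hom X Y),
    lunit Y ∘ tensm idm f = f ∘ lunit X;
  runit_nat : forall (X Y : mcat) (f : Hom X Y),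
    runit Y ∘ tensm f idm = f ∘ runit X;
  pentagon : forall X Y Z W : mcat,
    assoc X Y (tens Z W) ∘ assoc (tens X Y) Z W =
    tensm idm (assoc Y Z W) ∘ assoc X (tens Y Z) W ∘ tensm (assoc X Y Z) idm;
  triangle : forall X Y : mcat,
    tensm idm (lunit Y) ∘ assoc X munit Y = tensm (runit X) idm
}.

Arguments munit {m}.
Arguments assoc {m} X Y Z.
Arguments associ {m} X Y Z.
Arguments lunit {m} X.
Arguments luniti {m} X.
Arguments runit {m} X.
Arguments runiti {m} X.
Notation "X ⊗ Y" := (tens X Y) (at level 35, right associativity) : cat_scope.
Notation "f ⊗₁ g" := (tensm f g) (at level 35, right associativity) : cat_scope.
Notation "𝟙" := munit : cat_scope.

Record BraidedCategory : Type := MkBraided {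
  bcat :> MonoidalCategory;
  braid : forall X Y : bcat, Hom (X ⊗ Y) (Y ⊗ X);
  braidi : forall X Y : bcat, Hom (Y ⊗ X) (X ⊗ Y);
  braidK : forall X Y : bcat, braidi X Y ∘ braid X Y = idm;
  braidiK : forall X Y : bcat, braid X Y ∘ braidi X Y = idm;
  braid_nat : forall (X Y X' Y' : bcat) (f : Hom X X') (g : Hom Y Y'),
    braid X' Y' ∘ (f ⊗₁ g) = (g ⊗₁ f) ∘ braid X Y;
  hexagon : forall X Y Z : bcat,
    assoc Y Z X ∘ braid X (Y ⊗ Z) ∘ assoc X Y Z =
    (idm ⊗₁ braid X Z) ∘ assoc Y X Z ∘ (braid X Y ⊗₁ idm);
  hexagoni : forall X Y Z : bcat,
    associ Z X Y ∘ braid (X ⊗ Y) Z ∘ associ X Y Z =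
    (braid X Z ⊗₁ idm) ∘ associ X Z Y ∘ (idm ⊗₁ braid Y Z)
}.

Arguments braid {b} X Y.
Arguments braidi {b} X Y.

(* Right adjoints [ihom A] to the functors (- ⊗ A), given by universal arrows
   [ev A B]; functoriality of [ihom A] follows from [curry_uniq]. *)
Record ClosedStructure (C : MonoidalCategory) : Type := MkClosed {
  ihom : C -> C -> C;
  ev : forall A B : C, Hom (ihom A B ⊗ A) B;
  curry : forall P A B : C, Hom (P ⊗ A) B -> Hom P (ihom A B);
  curryK : forall (P A B : C) (psi : Hom (P ⊗ A) B),
    ev A B ∘ (curry psi ⊗₁ idm) = psi;
  curry_uniq : forall (P A B : C) (psi : Hom (P ⊗ A) B) (f : Hom P (ihom A B)),
    ev A B ∘ (f ⊗₁ idm) = psi -> f = curry psi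
}.

Section Monoids.
Variable C : MonoidalCategory.

Record MonoidOn (X : C) : Type := MkMonoidOn {
  mul : Hom (X ⊗ X) X;
  one : Hom 𝟙 X;
  mulA : mul ∘ (mul ⊗₁ idm) = mul ∘ (idm ⊗₁ mul) ∘ assoc X X X;
  mul1m : mul ∘ (one ⊗₁ idm) = lunit X;
  mulm1 : mul ∘ (idm ⊗₁ one) = runit X
}.

Record ComonoidOn (X : C) : Type := MkComonoidOn {
  comul : Hom X (X ⊗ X);
  counit : Hom X 𝟙;
  comulA : assoc X X X ∘ (comul ⊗₁ idm) ∘ comul = (idm ⊗₁ comul) ∘ comul;
  comul1m : lunit X ∘ (counit ⊗₁ idm) ∘ comul = idm;
  comulm1 : runit X ∘ (idm ⊗₁ counit) ∘ comul = idm
}.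

Record Monoid : Type := MkMonoid { mon_ob :> C; mon_str :> MonoidOn mon_ob }.
Record Comonoid : Type :=
  MkComonoid { comon_ob :> C; comon_str :> ComonoidOn comon_ob }.

Definition is_monoid_hom (X Y : C) (M : MonoidOn X) (N : MonoidOn Y)
    (f : Hom X Y) : Prop :=
  f ∘ mul M = mul N ∘ (f ⊗₁ f) /\ f ∘ one M = one N.

Definition is_comonoid_hom (X Y : C) (P : ComonoidOn X) (Q : ComonoidOn Y)
    (f : Hom X Y) : Prop :=
  (f ⊗₁ f) ∘ comul P = comul Q ∘ f /\ counit Q ∘ f = counit P.

Record Submonoid (M : Monoid) : Type := MkSubmonoid {
  sub_mon :> Monoid;
  incl : Hom sub_mon M;
  incl_hom : is_monoid_hom sub_mon M incl;
  incl_mono : is_mono incl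
}.

Definition is_module (X : C) (M : MonoidOn X) (A : C) (psi : Hom (X ⊗ A) A)
    : Prop :=
  psi ∘ (mul M ⊗₁ idm) = psi ∘ (idm ⊗₁ psi) ∘ assoc X X A /\
  psi ∘ (one M ⊗₁ idm) = lunit A.

End Monoids.

Arguments incl {C M} s.

Section EndMonoid.
Variables (C : MonoidalCategory) (K : ClosedStructure C) (A : C).

Let E : C := ihom K A A.

Definition end_mul : Hom (E ⊗ E) E :=
  curry K (ev K A A ∘ (idm ⊗₁ ev K A A) ∘ assoc E E A).

Definition end_one : Hom 𝟙 E := curry K (lunit A).

Lemma tensm_id_inj (X Y : C) (f g : Hom X Y) :
  @idm _ 𝟙 ⊗₁ f = @idm _ 𝟙 ⊗₁ g -> f = g.
Proof.
move=> fg; rewrite -(compm1 f) -(compm1 g) -(lunitiK X) !compA.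
by rewrite -!lunit_nat fg.
Qed.

Lemma lunit_tens (X Y : C) : lunit (X ⊗ Y) ∘ assoc 𝟙 X Y = lunit X ⊗₁ idm.
Proof.
apply: tensm_id_inj; set f := _ ⊗₁ _; set g := _ ⊗₁ _.
pose h := assoc 𝟙 (𝟙 ⊗ X) Y ∘ (assoc 𝟙 𝟙 X ⊗₁ @idm _ Y).
pose h' := (associ 𝟙 𝟙 X ⊗₁ @idm _ Y) ∘ associ 𝟙 (𝟙 ⊗ X) Y.
have hK : h ∘ h' = idm.
  rewrite /h /h' compA -(compA (assoc _ _ _) (tensm _ _)) -tensm_comp.
  by rewrite associK comp1m tensm1 compm1 associK.
suff fgh : f ∘ h = g ∘ h.
  by rewrite -(compm1 f) -(compm1 g) -hK (compA f) (compA g) fgh.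
rewrite /f /g /h.
rewrite -[X in X ⊗₁ (lunit _ ∘ _)](comp1m) tensm_comp -!compA.
rewrite [X in _ ∘ X]compA -pentagon compA triangle -tensm1 -assoc_nat.
rewrite compA -assoc_nat -compA -tensm_comp comp1m.
by rewrite triangle.
Qed.

Lemma end_inj (P : C) (f g : Hom P E) :
  ev K A A ∘ (f ⊗₁ idm) = ev K A A ∘ (g ⊗₁ idm) -> f = g.
Proof. by move=> fg; rewrite (curry_uniq fg) -(curry_uniq (erefl _)). Qed.

Lemma tensm_compl (X Y Z W : C) (g : Hom Y Z) (f : Hom X Y) :
  (g ∘ f) ⊗₁ @idm _ W = (g ⊗₁ idm) ∘ (f ⊗₁ idm).
Proof. by rewrite -tensm_comp comp1m. Qed.

Lemma tensm_compr (X Y Z W : C) (g : Hom Y Z) (f : Hom X Y) :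
  @idm _ W ⊗₁ (g ∘ f) = (idm ⊗₁ g) ∘ (idm ⊗₁ f).
Proof. by rewrite -tensm_comp comp1m. Qed.

Lemma tensm_exch (X Y X' Y' : C) (f : Hom X X') (g : Hom Y Y') :
  (idm ⊗₁ g) ∘ (f ⊗₁ idm) = (f ⊗₁ idm) ∘ (idm ⊗₁ g).
Proof. by rewrite -!tensm_comp !comp1m !compm1. Qed.

Lemma end_mulP :
  ev K A A ∘ (end_mul ⊗₁ idm) = ev K A A ∘ (idm ⊗₁ ev K A A) ∘ assoc E E A.
Proof. exact: curryK. Qed.

Lemma end_oneP : ev K A A ∘ (end_one ⊗₁ idm) = lunit A.
Proof. exact: curryK. Qed.

Lemma end_mulA :
  end_mul ∘ (end_mul ⊗₁ idm) = end_mul ∘ (idm ⊗₁ end_mul) ∘ assoc E E E.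
Proof.
apply: end_inj; rewrite !tensm_compl !compA end_mulP.
rewrite -!(compA _ (assoc _ _ _) (tensm _ _)) !assoc_nat tensm1 !compA.
rewrite -(compA _ (tensm idm (ev _ _ _)) (tensm end_mul _)) tensm_exch compA.
rewrite end_mulP -(compA _ (assoc _ _ _) (tensm idm _)) -tensm1 assoc_nat.
rewrite -!compA pentagon !compA; congr (_ ∘ _ ∘ _).
by rewrite -!(compA (ev _ _ _)) -!tensm_compr end_mulP.
Qed.

Lemma end_mul1m : end_mul ∘ (end_one ⊗₁ idm) = lunit E.
Proof.
apply: end_inj; rewrite tensm_compl compA end_mulP.
rewrite -(compA _ (assoc _ _ _)) assoc_nat tensm1 compA.
rewrite -(compA _ (tensm idm (ev _ _ _))) tensm_exch compA end_oneP.
by rewrite lunit_nat -compA lunit_tens.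
Qed.

Lemma end_mulm1 : end_mul ∘ (idm ⊗₁ end_one) = runit E.
Proof.
apply: end_inj; rewrite tensm_compl compA end_mulP.
rewrite -(compA _ (assoc _ _ _)) assoc_nat compA.
by rewrite -(compA (ev _ _ _)) -tensm_compr end_oneP -compA triangle.
Qed.

(* The monoid [A, A]; [ev] is a module structure by [end_mulP], [end_oneP]. *)
Definition end_monoid : Monoid C :=
  MkMonoid (MkMonoidOn end_mulA end_mul1m end_mulm1).

End EndMonoid.

Section Measurings.
Variable C : BraidedCategory.

(* id ⊗ c ⊗ id, with the associativity constraints made explicit *)
Definition interchange (X Y Z W : C) :
    Hom ((X ⊗ Y) ⊗ (Z ⊗ W)) ((X ⊗ Z) ⊗ (Y ⊗ W)) :=
  associ X Z (Y ⊗ W)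
  ∘ (idm ⊗₁ (assoc Z Y W ∘ (braid Y Z ⊗₁ idm) ∘ associ Y Z W))
  ∘ assoc X Y (Z ⊗ W).

Record is_bimonoid (X : C) (M : MonoidOn X) (D : ComonoidOn X) : Prop := {
  comul_mul : comul D ∘ mul M =
    (mul M ⊗₁ mul M) ∘ interchange X X X X ∘ (comul D ⊗₁ comul D);
  comul_one : comul D ∘ one M = (one M ⊗₁ one M) ∘ luniti 𝟙;
  counit_mul : counit D ∘ mul M = lunit 𝟙 ∘ (counit D ⊗₁ counit D);
  counit_one : counit D ∘ one M = idm
}.

Record Bimonoid : Type := MkBimonoid {
  bim_ob :> C;
  bim_mon : MonoidOn bim_ob;
  bim_comon : ComonoidOn bim_ob;
  bim_law : is_bimonoid bim_mon bim_comon
}.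

Definition is_bimonoid_hom (B B' : Bimonoid) (f : Hom B B') : Prop :=
  is_monoid_hom (bim_mon B) (bim_mon B') f /\
  is_comonoid_hom (bim_comon B) (bim_comon B') f.

Fixpoint tpow (A : C) (n : nat) : C :=
  if n is S n' then A ⊗ tpow A n' else 𝟙.

Definition ttens (P : C) (D : ComonoidOn P) (A1 A2 B1 B2 : C)
    (psi1 : Hom (P ⊗ A1) B1) (psi2 : Hom (P ⊗ A2) B2) :
    Hom (P ⊗ (A1 ⊗ A2)) (B1 ⊗ B2) :=
  (psi1 ⊗₁ psi2) ∘ interchange P P A1 A2 ∘ (comul D ⊗₁ idm).

Fixpoint ttens_pow (P : C) (D : ComonoidOn P) (A B : C)
    (psi : Hom (P ⊗ A) B) (n : nat) : Hom (P ⊗ tpow A n) (tpow B n) :=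
  match n with
  | 0 => counit D ∘ runit P
  | S n' => ttens D psi (ttens_pow D psi n')
  end.

Record Magma (Omega : Type) (s t : Omega -> nat) : Type := MkMagma {
  mag_ob :> C;
  mag_op : forall w : Omega, Hom (tpow mag_ob (s w)) (tpow mag_ob (t w))
}.

Section Actions.
Variables (Omega : Type) (s t : Omega -> nat).

Definition is_measuring (A B : Magma s t) (P : C) (D : ComonoidOn P)
    (psi : Hom (P ⊗ A) B) : Prop :=
  forall w : Omega,
    mag_op B w ∘ ttens_pow D psi (s w) =
    ttens_pow D psi (t w) ∘ (idm ⊗₁ mag_op A w).

Definition is_action (A : Magma s t) (B : Bimonoid) (psi : Hom (B ⊗ A) A)
    : Prop :=
  is_measuring (bim_comon B) psi /\ is_module (bim_mon B) psi.

Variables (K : ClosedStructure C) (A : Magma s t).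
Variable V : Submonoid (end_monoid K A).

(* The cosupport, a subobject of [A, A] determined up to isomorphism,
   is represented by a submonoid of V. *)
Definition cosupp_submonoid_of (P : C) (psi : Hom (P ⊗ A) A) : Prop :=
  exists S : Submonoid V, is_image (curry K psi) (incl V ∘ incl S).

(* Terminal among the measurings (P, psi) with K psi factoring through V. *)
Definition is_universal_measuring (U : Comonoid C) (psiU : Hom (U ⊗ A) A)
    : Prop :=
  [/\ is_measuring U psiU, factors_through (curry K psiU) (incl V) &
      forall (P : Comonoid C) (psi : Hom (P ⊗ A) A),
        is_measuring P psi -> factors_through (curry K psi) (incl V) ->
        exists! phi : Hom P U,
          is_comonoid_hom P U phi /\ psiU ∘ (phi ⊗₁ idm) = psi].

(* Terminal among the actions (B, psi) with K psi factoring through V. *)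
Definition is_universal_acting (U : Bimonoid) (psiU : Hom (U ⊗ A) A) : Prop :=
  [/\ is_action psiU, factors_through (curry K psiU) (incl V) &
      forall (B : Bimonoid) (psi : Hom (B ⊗ A) A),
        is_action psi -> factors_through (curry K psi) (incl V) ->
        exists! phi : Hom B U,
          is_bimonoid_hom phi /\ psiU ∘ (phi ⊗₁ idm) = psi].

End Actions.
End Measurings.

(* Main.v *)
From Corelib Require Import ssreflect ssrfun ssrbool.
Require Import Defs.
Local Open Scope cat_scope.

Set Implicit Arguments.
Unset Strict Implicit.
Unset Printing Implicit Defensive.

(** Let k = K psiU : U -> [A, A].  The idea is that k behaves like a
    monomorphism as far as comonoids are concerned: two comonoid homomorphisms
    f, g : P -> U with k f = k g are equal, because both represent the measuring
    psiU (f ⊗ id) = psiU (g ⊗ id), which factors through V and hence has a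
    unique representative ([universal_curry_cancel]).  So U can inherit a
    monoid structure from [A, A], just as a subobject closed under the
    operations would, as soon as multiplication and unit lift along k to
    comonoid homomorphisms U ⊗ U -> U and 𝟙 -> U.

    The lifts come from universality.  Acting twice,
    psiU (id ⊗ psiU) : (U ⊗ U) ⊗ A -> A, is a measuring for the tensor
    comonoid U ⊗ U ([measuring_comp]), and K sends it to the product
    mul (k ⊗ k) in [A, A] ([curry_act_comp]), which factors through V because V
    is a submonoid.  Likewise the left unit constraint of A is a measuring by
    𝟙 whose image under K is the unit of [A, A].  The monoid axioms of U then
    hold because they hold in [A, A] after composition with k and both sides of
    each are comonoid homomorphisms; this requires the associativity and unit
    constraints of comonoids to be comonoid homomorphisms.  A multiplication and
    a unit that are comonoid homomorphisms are exactly what makes a bimonoid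
    ([is_bimonoidP]), and k is a monoid homomorphism by construction, that is,
    psiU is an action.

    For an action psi of a bimonoid B, let phi : B -> U be the comonoid
    homomorphism representing psi.  The maps phi mul and mul (phi ⊗ phi) are
    comonoid homomorphisms B ⊗ B -> U with the same composite with k, since
    k phi = K psi is a monoid homomorphism; so they coincide, and similarly for
    the units.

    The remaining work is coherence for the interchange map
    (X ⊗ Y) ⊗ (Z ⊗ W) -> (X ⊗ Z) ⊗ (Y ⊗ W): it makes ⊗ a monoidal functor
    ([interchange_assoc], [lunit_interchange], [runit_interchange]), and the
    constraints are monoidal transformations ([assoc_monoidal],
    [lunit_monoidal], [runit_monoidal]).  Here the braiding need not be a
    symmetry, so both hexagons enter. *)

(** * Rewriting in composites *)

(** Matching is syntactic because the rewrite [-!compA] would also unfold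
    definitions, such as [interchange], whose bodies are composites. *)
Ltac reassoc :=
  repeat match goal with
  | |- context [comp (comp ?h ?g) ?f] => rewrite -(compA h g f)
  end.

Section Rewriting.
Variable C : Category.

(** The [comp_eq] lemmas turn an equation between composites into one that can
    be rewritten in the middle of a composite associated to the right. *)
Lemma comp_eq1 (X Y Z : C) (g : Hom Y Z) (f : Hom X Y) (h : Hom X Z) :
  g ∘ f = h -> forall (W : C) (e : Hom W X), g ∘ (f ∘ e) = h ∘ e.
Proof. by move=> <- W e; rewrite compA. Qed.

Lemma comp_eq2 (X Y Y' Z : C) (g : Hom Y Z) (f : Hom X Y) (k : Hom Y' Z)
    (h : Hom X Y') :
  g ∘ f = k ∘ h -> forall (W : C) (e : Hom W X), g ∘ (f ∘ e) = k ∘ (h ∘ e).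
Proof. by move=> gf W e; rewrite !compA gf. Qed.

Lemma comp_eq3 (X Y Z T : C) (h : Hom Z T) (g : Hom Y Z) (f : Hom X Y)
    (k : Hom X T) :
  h ∘ (g ∘ f) = k -> forall (W : C) (e : Hom W X), h ∘ (g ∘ (f ∘ e)) = k ∘ e.
Proof. by move=> <- W e; rewrite !compA. Qed.

Lemma comp_eq4 (X Y Z T S : C) (l : Hom T S) (h : Hom Z T) (g : Hom Y Z)
    (f : Hom X Y) (k : Hom X S) :
  l ∘ (h ∘ (g ∘ f)) = k ->
  forall (W : C) (e : Hom W X), l ∘ (h ∘ (g ∘ (f ∘ e))) = k ∘ e.
Proof. by move=> <- W e; rewrite !compA. Qed.

Lemma cancel_right (X Y Z : C) (e : Hom X Y) (r : Hom Y X) (f g : Hom Y Z) :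
  e ∘ r = idm -> f ∘ e = g ∘ e -> f = g.
Proof. by move=> er fg; rewrite -(compm1 f) -(compm1 g) -er !compA fg. Qed.

Lemma cancel_left (X Y Z : C) (m : Hom Y Z) (r : Hom Z Y) (f g : Hom X Y) :
  r ∘ m = idm -> m ∘ f = m ∘ g -> f = g.
Proof. by move=> rm fg; rewrite -(comp1m f) -(comp1m g) -rm -!compA fg. Qed.

End Rewriting.

(** * Unit and associativity constraints *)

Section Monoidal.
Variable C : MonoidalCategory.
Implicit Types X Y Z W : C.

Lemma tensm_postl X Y Z X' Y' (g : Hom Y Z) (f : Hom X Y) (h : Hom X' Y') :
  (g ∘ f) ⊗₁ h = (g ⊗₁ idm) ∘ (f ⊗₁ h).
Proof. by rewrite -tensm_comp comp1m. Qed.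

Lemma tensm_postr X Y Z X' Y' (g : Hom Y Z) (f : Hom X Y) (h : Hom X' Y') :
  h ⊗₁ (g ∘ f) = (idm ⊗₁ g) ∘ (h ⊗₁ f).
Proof. by rewrite -tensm_comp comp1m. Qed.

Lemma tensm_splitl X Y X' Y' (f : Hom X Y) (g : Hom X' Y') :
  f ⊗₁ g = (f ⊗₁ idm) ∘ (idm ⊗₁ g).
Proof. by rewrite -tensm_comp comp1m compm1. Qed.

Lemma tensm_splitr X Y X' Y' (f : Hom X Y) (g : Hom X' Y') :
  f ⊗₁ g = (idm ⊗₁ g) ∘ (f ⊗₁ idm).
Proof. by rewrite -tensm_comp comp1m compm1. Qed.

Lemma whisker_square W X Y Y' Z (g : Hom Y Z) (f : Hom X Y) (k : Hom Y' Z)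
    (h : Hom X Y') :
  g ∘ f = k ∘ h ->
  (@idm _ W ⊗₁ g) ∘ (idm ⊗₁ f) = (idm ⊗₁ k) ∘ (idm ⊗₁ h).
Proof. by move=> gf; rewrite -!tensm_compr gf. Qed.

Lemma assoc_natl X X' Y Z (f : Hom X X') :
  assoc X' Y Z ∘ ((f ⊗₁ idm) ⊗₁ idm) = (f ⊗₁ idm) ∘ assoc X Y Z.
Proof. by rewrite assoc_nat tensm1. Qed.

Lemma assoc_natm X Y Y' Z (f : Hom Y Y') :
  assoc X Y' Z ∘ ((idm ⊗₁ f) ⊗₁ idm) = (idm ⊗₁ (f ⊗₁ idm)) ∘ assoc X Y Z.
Proof. exact: assoc_nat. Qed.

Lemma assoc_natr X Y Z Z' (f : Hom Z Z') :
  assoc X Y Z' ∘ (idm ⊗₁ f) = (idm ⊗₁ (idm ⊗₁ f)) ∘ assoc X Y Z.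
Proof. by rewrite -assoc_nat tensm1. Qed.

Lemma associ_nat X Y Z X' Y' Z' (f : Hom X X') (g : Hom Y Y') (h : Hom Z Z') :
  associ X' Y' Z' ∘ (f ⊗₁ (g ⊗₁ h)) = ((f ⊗₁ g) ⊗₁ h) ∘ associ X Y Z.
Proof.
apply: (cancel_left (assocK X' Y' Z')).
rewrite (comp_eq1 (associK _ _ _)) comp1m (comp_eq2 (assoc_nat _ _ _)).
by rewrite associK compm1.
Qed.

Lemma pentagon_right X Y Z W :
  (idm ⊗₁ assoc Y Z W) ∘ (assoc X (Y ⊗ Z) W ∘ (assoc X Y Z ⊗₁ idm)) =
  assoc X Y (Z ⊗ W) ∘ assoc (X ⊗ Y) Z W.
Proof. by rewrite pentagon !compA. Qed.

Lemma pentagon_inverse X Y Z W :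
  assoc (X ⊗ Y) Z W ∘ (associ X Y Z ⊗₁ idm) =
  associ X Y (Z ⊗ W) ∘ ((idm ⊗₁ assoc Y Z W) ∘ assoc X (Y ⊗ Z) W).
Proof.
apply: (cancel_left (assocK X Y (Z ⊗ W))).
rewrite (comp_eq1 (associK _ _ _)) comp1m compA -pentagon_right.
by rewrite -!compA -tensm_comp associK comp1m tensm1 compm1.
Qed.

(** Both constraints become the same after composition with a unit constraint
    of 𝟙 ⊗ 𝟙, by [triangle] and [lunit_tens]. *)
Lemma lunit_munit : lunit 𝟙 = runit 𝟙 :> Hom (𝟙 ⊗ 𝟙) (𝟙 : C).
Proof.
apply: (cancel_right (runitiK (𝟙 ⊗ 𝟙))).
rewrite -!runit_nat -triangle -lunit_tens; congr (_ ∘ (_ ∘ _)).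
by apply: (cancel_left (lunitK 𝟙)); rewrite lunit_nat.
Qed.

(** The mirror image of [lunit_tens]. *)
Lemma runit_tens X Y : runit (X ⊗ Y) = (idm ⊗₁ runit Y) ∘ assoc X Y 𝟙.
Proof.
have tensm_id_injr Z (f g : Hom Z (X ⊗ Y)) :
    f ⊗₁ @idm _ 𝟙 = g ⊗₁ idm -> f = g.
  move=> fg; apply: (cancel_right (runitiK Z)).
  by rewrite -!runit_nat fg.
apply: tensm_id_injr; rewrite -triangle tensm_compl.
apply: (cancel_left (assocK X Y 𝟙)).
rewrite (comp_eq2 (assoc_natm _ _ _)) -triangle tensm_compr -!compA.
by rewrite pentagon_right -(tensm1 X Y) !compA assoc_nat.
Qed.

End Monoidal.

(** * Braiding the first two factors of a right-associated product *)

Section Swap.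
Variable C : BraidedCategory.
Implicit Types X Y Z W : C.

(** In a product associated to the right every braiding occurs with a rest Z.
    Working with this form makes coherence proofs a matter of flattening all
    products to the right; the naturality in Z replaces most associativity
    bookkeeping.  The lock keeps rewriting from seeing the composite inside. *)
Definition swap X Y Z : Hom (X ⊗ (Y ⊗ Z)) (Y ⊗ (X ⊗ Z)) :=
  locked (assoc Y X Z ∘ (braid X Y ⊗₁ idm) ∘ associ X Y Z).

Lemma swapE X Y Z :
  swap X Y Z = assoc Y X Z ∘ (braid X Y ⊗₁ idm) ∘ associ X Y Z.
Proof. by rewrite /swap -lock. Qed.

Lemma swap_assoc X Y Z :
  swap X Y Z ∘ assoc X Y Z = assoc Y X Z ∘ (braid X Y ⊗₁ idm).
Proof. by rewrite swapE -!compA assocK compm1. Qed.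

Lemma swap_nat X Y Z X' Y' Z' (f : Hom X X') (g : Hom Y Y') (h : Hom Z Z') :
  swap X' Y' Z' ∘ (f ⊗₁ (g ⊗₁ h)) = (g ⊗₁ (f ⊗₁ h)) ∘ swap X Y Z.
Proof.
rewrite !swapE -!compA associ_nat (compA (braid _ _ ⊗₁ _)) -tensm_comp braid_nat.
rewrite comp1m -{1}(compm1 h) tensm_comp -!compA.
by rewrite (comp_eq2 (assoc_nat _ _ _)).
Qed.

Lemma swap_natl X Y Z X' (f : Hom X X') :
  swap X' Y Z ∘ (f ⊗₁ idm) = (idm ⊗₁ (f ⊗₁ idm)) ∘ swap X Y Z.
Proof. by rewrite -swap_nat tensm1. Qed.

Lemma swap_natr X Y Z Z' (h : Hom Z Z') :
  swap X Y Z' ∘ (idm ⊗₁ (idm ⊗₁ h)) = (idm ⊗₁ (idm ⊗₁ h)) ∘ swap X Y Z.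
Proof. exact: swap_nat. Qed.

(** The pentagon, applied on either side of the braiding, lets the rest absorb a
    further factor on the right. *)
Lemma swap_whisker X Y Z W :
  (idm ⊗₁ assoc X Z W) ∘ (assoc Y (X ⊗ Z) W ∘ (swap X Y Z ⊗₁ idm)) =
  swap X Y (Z ⊗ W) ∘ ((idm ⊗₁ assoc Y Z W) ∘ assoc X (Y ⊗ Z) W).
Proof.
rewrite !swapE !tensm_compl -!compA -pentagon_inverse.
rewrite (compA (assoc Y _ W)) (compA (idm ⊗₁ _)) pentagon_right -!compA.
by rewrite (comp_eq2 (assoc_natl _ _ _)).
Qed.

Definition swapi X Y Z : Hom (Y ⊗ (X ⊗ Z)) (X ⊗ (Y ⊗ Z)) :=
  assoc X Y Z ∘ (braidi X Y ⊗₁ idm) ∘ associ Y X Z.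

Lemma swapK X Y Z : swapi X Y Z ∘ swap X Y Z = idm.
Proof.
rewrite swapE /swapi -!compA (comp_eq1 (assocK _ _ _)) comp1m.
by rewrite (compA (braidi _ _ ⊗₁ _)) -tensm_compl braidK tensm1 comp1m associK.
Qed.

Lemma swapiK X Y Z : swap X Y Z ∘ swapi X Y Z = idm.
Proof.
rewrite swapE /swapi -!compA (comp_eq1 (assocK _ _ _)) comp1m.
by rewrite (compA (braid _ _ ⊗₁ _)) -tensm_compl braidiK tensm1 comp1m associK.
Qed.

Lemma interchangeE X Y Z W :
  interchange X Y Z W =
  associ X Z (Y ⊗ W) ∘ (idm ⊗₁ swap Y Z W) ∘ assoc X Y (Z ⊗ W).
Proof. by rewrite swapE. Qed.

(** The two hexagons in flattened form: crossing a product is crossing its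
    factors one at a time. *)
Lemma swap_tensr X Y Z W :
  assoc Y Z (X ⊗ W) ∘ swap X (Y ⊗ Z) W =
  (idm ⊗₁ swap X Z W) ∘ (swap X Y (Z ⊗ W) ∘ (idm ⊗₁ assoc Y Z W)).
Proof.
apply: (cancel_right (associK X (Y ⊗ Z) W)).
have e : (assoc X Y Z ⊗₁ @idm _ W) ∘ (associ X Y Z ⊗₁ idm) = idm.
  by rewrite -tensm_comp associK comp1m tensm1.
apply: (cancel_right e); reassoc; rewrite pentagon_right.
rewrite (comp_eq2 (swap_assoc _ _ _)) (comp_eq2 (swap_assoc _ _ _)).
rewrite -assoc_natl (comp_eq1 (esym (pentagon_right _ _ _ _))); reassoc.
rewrite (comp_eq1 (esym (pentagon_right _ _ _ _))); reassoc.
rewrite -!tensm_compl (compA (assoc Y Z X)) hexagon (compA (idm ⊗₁ swap _ _ _)).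
rewrite -tensm_compr swap_assoc !tensm_compl !tensm_compr; reassoc.
by rewrite (comp_eq2 (assoc_natm _ _ _)).
Qed.

Lemma swap_tensl X Y Z W :
  (idm ⊗₁ assoc X Y W) ∘ swap (X ⊗ Y) Z W =
  swap X Z (Y ⊗ W) ∘ ((idm ⊗₁ swap Y Z W) ∘ assoc X Y (Z ⊗ W)).
Proof.
have hex : braid (X ⊗ Y) Z =
    swap X Z Y ∘ ((idm ⊗₁ braid Y Z) ∘ assoc X Y Z).
  apply: (cancel_left (associK Z X Y)); apply: (cancel_right (assocK X Y Z)).
  rewrite hexagoni swapE; reassoc.
  by rewrite associK compm1 (comp_eq1 (assocK _ _ _)) comp1m.
apply: (cancel_right (associK (X ⊗ Y) Z W)); reassoc.
rewrite swap_assoc hex !tensm_compl.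
rewrite (comp_eq3 (swap_whisker _ _ _ _)); reassoc.
rewrite -(pentagon_right X Y Z W) (comp_eq2 (assoc_natm _ _ _)).
congr (_ ∘ _); rewrite !compA -!tensm_compr.
by rewrite swap_assoc.
Qed.

(** By [swap_tensr], crossing 𝟙 ⊗ 𝟙 is crossing 𝟙 twice; by naturality it is
    also crossing 𝟙 once.  Cancelling the invertible [swap] leaves the claim for
    a rest of the form 𝟙 ⊗ Z, which suffices since 𝟙 ⊗ Z is isomorphic to Z. *)
Lemma swap_munitr X Z : lunit (X ⊗ Z) ∘ swap X 𝟙 Z = idm ⊗₁ lunit Z.
Proof.
have h : lunit (X ⊗ (𝟙 ⊗ Z)) ∘ swap X 𝟙 (𝟙 ⊗ Z) = idm ⊗₁ lunit (𝟙 ⊗ Z).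
  have e : (@idm _ X ⊗₁ assoc 𝟙 𝟙 Z) ∘ (idm ⊗₁ associ 𝟙 𝟙 Z) = idm.
    by rewrite -tensm_comp associK comp1m tensm1.
  apply: (cancel_right e); apply: (cancel_left (swapK X 𝟙 Z)).
  reassoc; rewrite -tensm_compr lunit_tens -(comp_eq2 (lunit_nat _)).
  by rewrite -swap_tensr (comp_eq1 (lunit_tens _ _)) swap_nat tensm1.
have e : (@idm _ X ⊗₁ (@idm _ 𝟙 ⊗₁ lunit Z)) ∘ (idm ⊗₁ (idm ⊗₁ luniti Z)) = idm.
  by rewrite -!tensm_compr lunitiK !tensm1.
apply: (cancel_right e); reassoc; rewrite swap_natr (comp_eq2 (lunit_nat _)) h.
by rewrite -!tensm_compr lunit_nat.
Qed.

(** The same argument as for [swap_munitr], with the other hexagon. *)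
Lemma swap_munitl Y Z : (idm ⊗₁ lunit Z) ∘ swap 𝟙 Y Z = lunit (Y ⊗ Z).
Proof.
have h : (idm ⊗₁ lunit (𝟙 ⊗ Z)) ∘ swap 𝟙 Y (𝟙 ⊗ Z) = lunit (Y ⊗ (𝟙 ⊗ Z)).
  have e : (@idm _ 𝟙 ⊗₁ swap 𝟙 Y Z) ∘ (idm ⊗₁ swapi 𝟙 Y Z) = idm.
    by rewrite -tensm_comp swapiK comp1m tensm1.
  apply: (cancel_right e); apply: (cancel_right (associK 𝟙 𝟙 (Y ⊗ Z))).
  reassoc; rewrite -swap_tensl compA -tensm_compr lunit_tens -swap_natl.
  by rewrite -lunit_tens -(comp_eq2 (lunit_nat _)).
have e : (@idm _ 𝟙 ⊗₁ (@idm _ Y ⊗₁ lunit Z)) ∘ (idm ⊗₁ (idm ⊗₁ luniti Z)) = idm.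
  by rewrite -!tensm_compr lunitiK !tensm1.
apply: (cancel_right e); reassoc; rewrite swap_natr lunit_nat -h.
by rewrite !compA -!tensm_compr lunit_nat.
Qed.

(** * Coherence of the interchange map *)

Lemma interchange_nat X Y Z W X' Y' Z' W' (f : Hom X X') (g : Hom Y Y')
    (h : Hom Z Z') (k : Hom W W') :
  interchange X' Y' Z' W' ∘ ((f ⊗₁ g) ⊗₁ (h ⊗₁ k)) =
  ((f ⊗₁ h) ⊗₁ (g ⊗₁ k)) ∘ interchange X Y Z W.
Proof.
rewrite !interchangeE; reassoc; rewrite (assoc_nat f g (h ⊗₁ k)).
rewrite (compA (idm ⊗₁ _)) -tensm_comp comp1m swap_nat.
rewrite -{1}(compm1 f) tensm_comp; reassoc.
by rewrite (comp_eq2 (associ_nat _ _ _)).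
Qed.

Lemma assoc_interchange X Y Z W :
  assoc X Z (Y ⊗ W) ∘ interchange X Y Z W =
  (idm ⊗₁ swap Y Z W) ∘ assoc X Y (Z ⊗ W).
Proof.
by rewrite interchangeE; reassoc; rewrite (comp_eq1 (associK _ _ _)) comp1m.
Qed.

(** The form of [assoc_interchange] in the presence of a further factor: once
    source and target are flattened, only the crossing of X2 and Y1 is left. *)
Lemma flatten_interchange X1 X2 Y1 Y2 Z :
  (idm ⊗₁ (idm ⊗₁ assoc X2 Y2 Z)) ∘ (assoc X1 Y1 ((X2 ⊗ Y2) ⊗ Z) ∘
    (assoc (X1 ⊗ Y1) (X2 ⊗ Y2) Z ∘ (interchange X1 X2 Y1 Y2 ⊗₁ idm))) =
  (idm ⊗₁ swap X2 Y1 (Y2 ⊗ Z)) ∘ ((idm ⊗₁ (idm ⊗₁ assoc Y1 Y2 Z)) ∘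
    (assoc X1 X2 ((Y1 ⊗ Y2) ⊗ Z) ∘ assoc (X1 ⊗ X2) (Y1 ⊗ Y2) Z)).
Proof.
rewrite (comp_eq1 (esym (pentagon_right X1 Y1 _ _))) -(pentagon_right X1 X2).
reassoc.
rewrite -tensm_compl assoc_interchange tensm_compl.
rewrite (comp_eq2 (assoc_natm _ _ _)).
rewrite !compA -!tensm_compr; reassoc.
by rewrite swap_whisker.
Qed.

(** Associativity of the monoidal functor ⊗.  After flattening, both sides
    take X1 X2 X3 Y1 Y2 Y3 to X1 Y1 X2 Y2 X3 Y3; one moves X3 across Y1 ⊗ Y2,
    the other moves X2 ⊗ X3 across Y1, and the hexagons split both into the same
    three crossings. *)
Lemma interchange_assoc X1 X2 X3 Y1 Y2 Y3 :
  assoc (X1 ⊗ Y1) (X2 ⊗ Y2) (X3 ⊗ Y3) ∘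
    ((interchange X1 X2 Y1 Y2 ⊗₁ idm) ∘
     interchange (X1 ⊗ X2) X3 (Y1 ⊗ Y2) Y3) =
  (idm ⊗₁ interchange X2 X3 Y2 Y3) ∘
    (interchange X1 (X2 ⊗ X3) Y1 (Y2 ⊗ Y3) ∘
     (assoc X1 X2 X3 ⊗₁ assoc Y1 Y2 Y3)).
Proof.
apply: (cancel_left (assocK X1 Y1 _)).
have e : (@idm _ X1 ⊗₁ (@idm _ Y1 ⊗₁ associ X2 Y2 (X3 ⊗ Y3))) ∘
    (idm ⊗₁ (idm ⊗₁ assoc X2 Y2 (X3 ⊗ Y3))) = idm.
  by rewrite -!tensm_compr assocK !tensm1.
apply: (cancel_left e).
rewrite (tensm_splitl (assoc X1 X2 X3)).
rewrite (comp_eq2 (assoc_natr _ _ _)) (comp_eq2 (assoc_interchange _ _ _ _)).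
rewrite (comp_eq4 (flatten_interchange _ _ _ _ _)); reassoc.
rewrite assoc_interchange (comp_eq2 (assoc_natr _ _ _)).
rewrite (compA (idm ⊗₁ (idm ⊗₁ assoc X2 _ _))) -!tensm_compr assoc_interchange.
rewrite (compA (idm ⊗₁ (idm ⊗₁ assoc Y1 _ _))) -!tensm_compr swap_tensr.
rewrite !tensm_compr; reassoc.
rewrite (comp_eq2 (whisker_square _ (swap_tensl _ _ _ _))) tensm_compr; reassoc.
rewrite (comp_eq3 (pentagon_right _ _ _ _)); reassoc.
rewrite !assoc_natr (comp_eq2 (assoc_natr _ _ _)).
by rewrite (comp_eq2 (whisker_square _ (swap_natr _ _ _))).
Qed.

(** Monoidality of the associator.  After flattening, both sides take
    X X' Y Y' Z Z' to X Y Z X' Y' Z' by the same three crossings, as in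
    [interchange_assoc].  It serves twice below: for the associator of
    comonoids, and for composites of measurings. *)
Lemma assoc_monoidal X X' Y Y' Z Z' :
  (assoc X Y Z ⊗₁ assoc X' Y' Z') ∘
    (interchange (X ⊗ Y) (X' ⊗ Y') Z Z' ∘ (interchange X X' Y Y' ⊗₁ idm)) =
  interchange X X' (Y ⊗ Z) (Y' ⊗ Z') ∘
    ((idm ⊗₁ interchange Y Y' Z Z') ∘ assoc (X ⊗ X') (Y ⊗ Y') (Z ⊗ Z')).
Proof.
apply: (cancel_left (assocK X (Y ⊗ Z) _)).
have e : (@idm _ X ⊗₁ (associ Y Z (X' ⊗ (Y' ⊗ Z')))) ∘
    (idm ⊗₁ assoc Y Z _) = idm.
  by rewrite -!tensm_compr assocK !tensm1.
apply: (cancel_left e).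
rewrite (tensm_splitl (assoc X Y Z)).
reassoc; rewrite (comp_eq2 (assoc_interchange _ _ _ _)).
rewrite (comp_eq3 (pentagon_right _ _ _ _)); reassoc.
rewrite (comp_eq2 (assoc_natr _ _ _)) (comp_eq2 (assoc_interchange _ _ _ _)).
rewrite !(comp_eq2 (assoc_natr _ _ _)).
rewrite (comp_eq2 (whisker_square _ (whisker_square _ (swap_tensl _ _ _ _)))).
rewrite 2!tensm_compr; reassoc; rewrite flatten_interchange.
rewrite (comp_eq2 (whisker_square _ (swap_tensr _ _ _ _))) tensm_compr; reassoc.
rewrite (comp_eq2 (whisker_square _ (whisker_square _ (assoc_interchange _ _ _ _)))).
by rewrite (comp_eq2 (whisker_square _ (swap_natr _ _ _))).
Qed.

Lemma lunit_interchange X Y :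
  lunit (X ⊗ Y) ∘ ((lunit 𝟙 ⊗₁ idm) ∘ interchange 𝟙 X 𝟙 Y) =
  lunit X ⊗₁ lunit Y.
Proof.
rewrite -lunit_tens; reassoc; rewrite assoc_interchange.
rewrite (comp_eq2 (lunit_nat _)) lunit_tens compA swap_munitr.
by rewrite -tensm_comp comp1m compm1.
Qed.

Lemma runit_interchange X Y :
  runit (X ⊗ Y) ∘ ((idm ⊗₁ lunit 𝟙) ∘ interchange X 𝟙 Y 𝟙) =
  runit X ⊗₁ runit Y.
Proof.
rewrite runit_tens; reassoc; rewrite (comp_eq2 (assoc_natr _ _ _)).
rewrite assoc_interchange !compA -!tensm_compr; reassoc.
rewrite swap_munitl tensm_compr; reassoc.
by rewrite triangle -tensm_comp comp1m compm1.
Qed.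

Lemma lunit_monoidal X Y :
  (lunit X ⊗₁ lunit Y) ∘ interchange 𝟙 𝟙 X Y = lunit (X ⊗ Y) ∘ (lunit 𝟙 ⊗₁ idm).
Proof.
rewrite (tensm_splitr (lunit X)).
rewrite -!lunit_tens; reassoc; rewrite assoc_interchange.
by rewrite (comp_eq2 (lunit_nat _)) !compA swap_munitl.
Qed.

Lemma runit_monoidal X Y :
  (runit X ⊗₁ runit Y) ∘ interchange X Y 𝟙 𝟙 = runit (X ⊗ Y) ∘ (idm ⊗₁ lunit 𝟙).
Proof.
rewrite (tensm_splitr (runit X)).
rewrite -!triangle runit_tens; reassoc; rewrite assoc_interchange assoc_natr.
by rewrite !compA -!tensm_compr -(compA (runit _)) swap_munitr.
Qed.

End Swap.

(** * The monoidal category of comonoids *)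

Section Comonoids.
Variable C : BraidedCategory.
Implicit Types X Y Z W : C.

Lemma munit_comulA :
  assoc 𝟙 𝟙 𝟙 ∘ (luniti 𝟙 ⊗₁ idm) ∘ luniti 𝟙 =
  (idm ⊗₁ luniti 𝟙) ∘ luniti 𝟙 :> Hom (𝟙 : C) _.
Proof.
congr (_ ∘ _).
have e : (lunit 𝟙 ⊗₁ @idm _ (𝟙 : C)) ∘ (luniti 𝟙 ⊗₁ idm) = idm.
  by rewrite -tensm_compl lunitiK tensm1.
apply: (cancel_right e); reassoc; rewrite -tensm_compl lunitK tensm1 compm1.
rewrite lunit_munit -triangle compA -tensm_compr.
by rewrite lunitK tensm1 comp1m.
Qed.

Lemma munit_comul1m :
  lunit 𝟙 ∘ (idm ⊗₁ idm) ∘ luniti 𝟙 = idm :> Hom (𝟙 : C) 𝟙.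
Proof. by rewrite tensm1 compm1 lunitiK. Qed.

Lemma munit_comulm1 :
  runit 𝟙 ∘ (idm ⊗₁ idm) ∘ luniti 𝟙 = idm :> Hom (𝟙 : C) 𝟙.
Proof. by rewrite -lunit_munit munit_comul1m. Qed.

Definition munit_comonoid : ComonoidOn (𝟙 : C) :=
  MkComonoidOn munit_comulA munit_comul1m munit_comulm1.

Section Tensor.
Variables (X Y : C) (P : ComonoidOn X) (Q : ComonoidOn Y).

Definition tensor_comul : Hom (X ⊗ Y) ((X ⊗ Y) ⊗ (X ⊗ Y)) :=
  interchange X X Y Y ∘ (comul P ⊗₁ comul Q).

Definition tensor_counit : Hom (X ⊗ Y) 𝟙 :=
  lunit 𝟙 ∘ (counit P ⊗₁ counit Q).

Lemma tensor_comulA :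
  assoc _ _ _ ∘ (tensor_comul ⊗₁ idm) ∘ tensor_comul =
  (idm ⊗₁ tensor_comul) ∘ tensor_comul.
Proof.
rewrite /tensor_comul tensm_compl tensm_compr; reassoc.
rewrite -!(tensm1 X Y) -!(comp_eq2 (interchange_nat _ _ _ _)).
rewrite tensm1 (comp_eq3 (interchange_assoc _ _ _ _ _ _)); reassoc.
by rewrite -!tensm_comp; congr (_ ∘ (_ ∘ (_ ⊗₁ _))); rewrite compA comulA.
Qed.

Lemma tensor_comul1m :
  lunit _ ∘ (tensor_counit ⊗₁ idm) ∘ tensor_comul = idm.
Proof.
rewrite /tensor_comul /tensor_counit tensm_compl; reassoc.
rewrite -!(tensm1 X Y) -!(comp_eq2 (interchange_nat _ _ _ _)).
rewrite tensm1 (comp_eq3 (lunit_interchange _ _)) -!tensm_comp.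
by rewrite !compA !comul1m tensm1.
Qed.

Lemma tensor_comulm1 :
  runit _ ∘ (idm ⊗₁ tensor_counit) ∘ tensor_comul = idm.
Proof.
rewrite /tensor_comul /tensor_counit tensm_compr; reassoc.
rewrite -!(tensm1 X Y) -!(comp_eq2 (interchange_nat _ _ _ _)).
rewrite tensm1 (comp_eq3 (runit_interchange _ _)) -!tensm_comp.
by rewrite !compA !comulm1 tensm1.
Qed.

Definition tensor_comonoid : ComonoidOn (X ⊗ Y) :=
  MkComonoidOn tensor_comulA tensor_comul1m tensor_comulm1.

End Tensor.

Lemma comonoid_hom_id X (P : ComonoidOn X) : is_comonoid_hom P P idm.
Proof. by split; rewrite ?tensm1 ?comp1m ?compm1. Qed.

Lemma comonoid_hom_comp X Y Z (P : ComonoidOn X) (Q : ComonoidOn Y)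
    (R : ComonoidOn Z) (g : Hom Y Z) (f : Hom X Y) :
  is_comonoid_hom Q R g -> is_comonoid_hom P Q f -> is_comonoid_hom P R (g ∘ f).
Proof.
move=> [gD gE] [fD fE]; split; last by rewrite compA gE.
by rewrite tensm_comp -compA fD compA gD compA.
Qed.

Lemma comonoid_hom_tensor X Y X' Y' (P : ComonoidOn X) (Q : ComonoidOn Y)
    (P' : ComonoidOn X') (Q' : ComonoidOn Y') (f : Hom X X') (g : Hom Y Y') :
  is_comonoid_hom P P' f -> is_comonoid_hom Q Q' g ->
  is_comonoid_hom (tensor_comonoid P Q) (tensor_comonoid P' Q') (f ⊗₁ g).
Proof.
move=> [fD fE] [gD gE]; split => /=.
  rewrite /tensor_comul compA -interchange_nat; reassoc.
  by rewrite -!tensm_comp fD gD.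
by rewrite /tensor_counit -compA -tensm_comp fE gE.
Qed.

Lemma comonoid_hom_assoc X Y Z (P : ComonoidOn X) (Q : ComonoidOn Y)
    (R : ComonoidOn Z) :
  is_comonoid_hom (tensor_comonoid (tensor_comonoid P Q) R)
    (tensor_comonoid P (tensor_comonoid Q R)) (assoc X Y Z).
Proof.
split => /=.
  rewrite /tensor_comul /= tensm_postl tensm_postr.
  rewrite (comp_eq3 (assoc_monoidal _ _ _ _ _ _)); reassoc.
  by rewrite assoc_nat.
rewrite /tensor_counit /= tensm_postl tensm_postr.
reassoc; rewrite -assoc_nat (compA (idm ⊗₁ _)) triangle.
by rewrite lunit_munit.
Qed.

Lemma comonoid_hom_lunit X (P : ComonoidOn X) :
  is_comonoid_hom (tensor_comonoid munit_comonoid P) P (lunit X).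
Proof.
split; rewrite /= ?/tensor_comul ?/tensor_counit /=; last first.
  by rewrite lunit_nat.
rewrite compA lunit_monoidal; reassoc; rewrite -tensm_comp lunitiK comp1m.
by rewrite lunit_nat.
Qed.

Lemma comonoid_hom_runit X (P : ComonoidOn X) :
  is_comonoid_hom (tensor_comonoid P munit_comonoid) P (runit X).
Proof.
split; rewrite /= ?/tensor_comul ?/tensor_counit /=; last first.
  by rewrite lunit_munit runit_nat.
rewrite compA runit_monoidal; reassoc; rewrite -tensm_comp lunitiK comp1m.
by rewrite runit_nat.
Qed.

(** In this form the bimonoid laws are statements about comonoid homomorphisms,
    hence within reach of a universal property among comonoids. *)
Lemma is_bimonoidP (X : C) (M : MonoidOn X) (D : ComonoidOn X) :
  is_bimonoid M D <->
  is_comonoid_hom (tensor_comonoid D D) D (mul M) /\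
  is_comonoid_hom munit_comonoid D (one M).
Proof.
split=> [[DM D1 EM E1] | [[DM EM] [D1 E1]]].
  by split; split=> //=; rewrite /tensor_comul compA.
by split=> //; rewrite -?DM -?D1 //= /tensor_comul compA.
Qed.

End Comonoids.

(** * Restricting and composing measurings *)

Section MeasuringCalculus.
Variable C : BraidedCategory.
Implicit Types P Q X Y Z : C.

Definition act_comp P Q X Y Z (psi : Hom (P ⊗ Y) Z) (phi : Hom (Q ⊗ X) Y) :
    Hom ((P ⊗ Q) ⊗ X) Z :=
  psi ∘ (idm ⊗₁ phi) ∘ assoc P Q X.

Lemma ttens_pullback P Q (D : ComonoidOn P) (E : ComonoidOn Q) X1 X2 Y1 Y2
    (psi1 : Hom (P ⊗ X1) Y1) (psi2 : Hom (P ⊗ X2) Y2) (f : Hom Q P) :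
  is_comonoid_hom E D f ->
  ttens E (psi1 ∘ (f ⊗₁ idm)) (psi2 ∘ (f ⊗₁ idm)) =
  ttens D psi1 psi2 ∘ (f ⊗₁ idm).
Proof.
move=> [fD _]; rewrite /ttens tensm_comp; reassoc.
rewrite -tensm_compl -fD tensm_compl -(comp_eq2 (interchange_nat _ _ _ _)).
by rewrite tensm1.
Qed.

Lemma ttens_pow_pullback P Q (D : ComonoidOn P) (E : ComonoidOn Q) X Y
    (psi : Hom (P ⊗ X) Y) (f : Hom Q P) n :
  is_comonoid_hom E D f ->
  ttens_pow E (psi ∘ (f ⊗₁ idm)) n = ttens_pow D psi n ∘ (f ⊗₁ idm).
Proof.
move=> fP; elim: n => [|n IHn] /=; last by rewrite IHn (ttens_pullback _ _ fP).
by rewrite -compA runit_nat compA fP.2.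
Qed.

(** Acting twice on a product can be done factor by factor.  The two sides
    differ by the order in which the copies of P and Q and the factors X1, X2
    are shuffled, which is [assoc_monoidal]. *)
Lemma ttens_act_comp P Q (D : ComonoidOn P) (E : ComonoidOn Q) X1 X2 Y1 Y2 Z1 Z2
    (psi1 : Hom (P ⊗ Y1) Z1) (psi2 : Hom (P ⊗ Y2) Z2)
    (phi1 : Hom (Q ⊗ X1) Y1) (phi2 : Hom (Q ⊗ X2) Y2) :
  ttens (tensor_comonoid D E) (act_comp psi1 phi1) (act_comp psi2 phi2) =
  act_comp (ttens D psi1 psi2) (ttens E phi1 phi2).
Proof.
rewrite /ttens /act_comp /= /tensor_comul !tensm_comp tensm_compl 2!tensm_compr.
reassoc; rewrite (comp_eq3 (assoc_monoidal _ _ _ _ _ _)); reassoc.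
rewrite -(comp_eq2 (interchange_nat _ _ _ _)) assoc_nat !tensm1.
rewrite (tensm_splitl (comul D)).
by reassoc; rewrite !(comp_eq2 (tensm_exch _ _)).
Qed.

Lemma ttens_pow_act_comp P Q (D : ComonoidOn P) (E : ComonoidOn Q) X Y Z
    (psi : Hom (P ⊗ Y) Z) (phi : Hom (Q ⊗ X) Y) n :
  ttens_pow (tensor_comonoid D E) (act_comp psi phi) n =
  act_comp (ttens_pow D psi n) (ttens_pow E phi n).
Proof.
elim: n => [|n IHn] /=; last by rewrite IHn ttens_act_comp.
rewrite /act_comp /tensor_counit tensm_compr; reassoc.
rewrite -runit_tens -(comp_eq2 (runit_nat (counit D))) lunit_munit.
by rewrite (compA (counit D ⊗₁ idm)) -tensm_comp comp1m compm1.
Qed.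

Lemma ttens_pow_lunit X n : ttens_pow (munit_comonoid C) (lunit X) n = lunit _.
Proof.
elim: n => [|n IHn] /=; first by rewrite comp1m lunit_munit.
rewrite IHn /ttens /= lunit_monoidal -compA -tensm_compl lunitiK.
by rewrite tensm1 compm1.
Qed.

Section Measuring.
Variables (Omega : Type) (s t : Omega -> nat).

Lemma measuring_pullback (A B : Magma C s t) P Q (D : ComonoidOn P)
    (E : ComonoidOn Q) (psi : Hom (P ⊗ A) B) (f : Hom Q P) :
  is_comonoid_hom E D f -> is_measuring D psi ->
  is_measuring E (psi ∘ (f ⊗₁ idm)).
Proof.
move=> fP psiP w; rewrite !(ttens_pow_pullback _ _ fP) compA psiP.
by reassoc; rewrite tensm_exch.
Qed.

Lemma measuring_comp (A B B' : Magma C s t) P Q (D : ComonoidOn P)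
    (E : ComonoidOn Q) (psi : Hom (P ⊗ B) B') (phi : Hom (Q ⊗ A) B) :
  is_measuring D psi -> is_measuring E phi ->
  is_measuring (tensor_comonoid D E) (act_comp psi phi).
Proof.
move=> psiP phiP w; rewrite !ttens_pow_act_comp /act_comp !compA psiP.
by reassoc; rewrite assoc_natr (comp_eq2 (whisker_square _ (phiP w))).
Qed.

Lemma measuring_lunit (A : Magma C s t) :
  is_measuring (munit_comonoid C) (lunit A).
Proof. by move=> w; rewrite !ttens_pow_lunit lunit_nat. Qed.

End Measuring.
End MeasuringCalculus.

(** * Measurings and the monoid [A, A] *)

Section Closed.
Variables (C : MonoidalCategory) (K : ClosedStructure C).

Lemma curry_pullback (P Q A B : C) (psi : Hom (P ⊗ A) B) (f : Hom Q P) :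
  curry K psi ∘ f = curry K (psi ∘ (f ⊗₁ idm)).
Proof. by apply: curry_uniq; rewrite tensm_compl compA curryK. Qed.

Lemma curry_inj (P A B : C) (psi phi : Hom (P ⊗ A) B) :
  curry K psi = curry K phi -> psi = phi.
Proof. by move=> eq_curry; rewrite -(curryK K psi) eq_curry curryK. Qed.

End Closed.

Section EndValued.
Variables (C : BraidedCategory) (K : ClosedStructure C).

(** The product of [A, A] is defined by acting twice through [ev]. *)
Lemma curry_act_comp (A P Q : C) (psi : Hom (P ⊗ A) A) (phi : Hom (Q ⊗ A) A) :
  curry K (act_comp psi phi) =
  mul (end_monoid K A) ∘ (curry K psi ⊗₁ curry K phi).
Proof.
apply/esym/curry_uniq; rewrite tensm_compl compA end_mulP; reassoc.
rewrite assoc_nat /act_comp; reassoc.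
rewrite (compA (idm ⊗₁ _)) -tensm_comp comp1m curryK.
by rewrite tensm_splitl !compA curryK.
Qed.

Lemma is_moduleP (A P : C) (M : MonoidOn P) (psi : Hom (P ⊗ A) A) :
  is_module M psi <-> is_monoid_hom M (end_monoid K A) (curry K psi).
Proof.
split=> [[psiM psi1]|[psiM psi1]].
  split; rewrite curry_pullback; last by rewrite psi1.
  by rewrite psiM -curry_act_comp.
split; apply: (curry_inj (K := K)).
  by rewrite -curry_pullback psiM -curry_act_comp.
by rewrite -curry_pullback psi1.
Qed.

Variables (A : C) (V : Submonoid (end_monoid K A)).

Lemma factors_act_comp (P Q : C) (psi : Hom (P ⊗ A) A) (phi : Hom (Q ⊗ A) A) :
  factors_through (curry K psi) (incl V) ->
  factors_through (curry K phi) (incl V) ->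
  factors_through (curry K (act_comp psi phi)) (incl V).
Proof.
move=> [f psif] [g phig]; exists (mul V ∘ (f ⊗₁ g)).
by rewrite curry_act_comp psif phig tensm_comp !compA (incl_hom V).1.
Qed.

Lemma factors_lunit : factors_through (curry K (lunit A)) (incl V).
Proof. by exists (one V); rewrite (incl_hom V).2. Qed.

End EndValued.

(** * The bimonoid structure on the universal measuring comonoid *)

Section Universal.
Variables (C : BraidedCategory) (K : ClosedStructure C).
Variables (Omega : Type) (s t : Omega -> nat) (A : Magma C s t).
Variable V : Submonoid (end_monoid K A).

(** The epimorphic part of the factorization of K psi composed with the
    inclusion of the cosupport in V is the required factor. *)
Lemma cosupp_factors (P : C) (psi : Hom (P ⊗ A) A) :
  cosupp_submonoid_of V psi -> factors_through (curry K psi) (incl V).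
Proof.
by move=> [S [_ [e [_ psie]]]]; exists (incl S ∘ e); rewrite psie compA.
Qed.

Variables (U : Comonoid C) (psiU : Hom (U ⊗ A) A).
Hypothesis HU : is_universal_measuring V psiU.

(** K psiU is left cancellable among comonoid homomorphisms: f and g represent
    the same measuring, so terminality of U identifies them. *)
Lemma universal_curry_cancel (P : C) (D : ComonoidOn P) (f g : Hom P U) :
  is_comonoid_hom D U f -> is_comonoid_hom D U g ->
  curry K psiU ∘ f = curry K psiU ∘ g -> f = g.
Proof.
case: HU => psiUm [k psiUk] univ fP gP; rewrite !curry_pullback => /curry_inj fg.
have psiM : is_measuring D (psiU ∘ (f ⊗₁ idm)) := measuring_pullback fP psiUm.
have psiV : factors_through (curry K (psiU ∘ (f ⊗₁ idm))) (incl V).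
  by exists (k ∘ f); rewrite -curry_pullback psiUk compA.
have [phi [_ phi_uniq]] := univ (MkComonoid D) _ psiM psiV.
by rewrite -(phi_uniq f) // -(phi_uniq g).
Qed.

(** The product represents the measuring by which U acts twice. *)
Lemma universal_mul_exists : exists m : Hom (U ⊗ U) U,
  is_comonoid_hom (tensor_comonoid U U) U m /\
  curry K psiU ∘ m =
    mul (end_monoid K A) ∘ (curry K psiU ⊗₁ curry K psiU).
Proof.
case: HU => psiUm psiUk univ.
have [m [[mP mE] _]] := univ (MkComonoid (tensor_comonoid U U)) _
  (measuring_comp psiUm psiUm) (factors_act_comp psiUk psiUk).
by exists m; split=> //; rewrite curry_pullback mE curry_act_comp.
Qed.

(** The unit represents the trivial measuring, by the comonoid 𝟙. *)
Lemma universal_one_exists : exists e : Hom 𝟙 U,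
  is_comonoid_hom (munit_comonoid C) U e /\
  curry K psiU ∘ e = one (end_monoid K A).
Proof.
case: HU => _ _ univ.
have [e [[eP eE] _]] := univ (MkComonoid (munit_comonoid C)) _
  (@measuring_lunit _ _ _ _ A) (factors_lunit V).
by exists e; split=> //; rewrite curry_pullback eE.
Qed.

(** Each axiom equates two comonoid homomorphisms into U, so by
    [universal_curry_cancel] it can be checked in [A, A]. *)
Lemma universal_monoid_exists : exists M : MonoidOn U,
  [/\ is_comonoid_hom (tensor_comonoid U U) U (mul M),
      is_comonoid_hom (munit_comonoid C) U (one M) &
      is_monoid_hom M (end_monoid K A) (curry K psiU)].
Proof.
have [m [mP mE]] := universal_mul_exists.
have [e [eP eE]] := universal_one_exists.
have idP := comonoid_hom_id U.
have mA : m ∘ (m ⊗₁ idm) = m ∘ (idm ⊗₁ m) ∘ assoc U U U.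
  have mlP := comonoid_hom_comp mP (comonoid_hom_tensor mP idP).
  have mrP := comonoid_hom_comp (comonoid_hom_comp mP
    (comonoid_hom_tensor idP mP)) (comonoid_hom_assoc U U U).
  apply: (universal_curry_cancel mlP mrP).
  rewrite !compA mE -!(compA (mul _)) -!tensm_comp !compm1 mE.
  rewrite tensm_postl tensm_postr -(compA _ _ (assoc U U U)) -assoc_nat !compA.
  by rewrite (mulA (end_monoid K A)).
have m1l : m ∘ (e ⊗₁ idm) = lunit U.
  have mlP := comonoid_hom_comp mP (comonoid_hom_tensor eP idP).
  apply: (universal_curry_cancel mlP (comonoid_hom_lunit U)).
  rewrite compA mE -compA -tensm_comp eE compm1 -lunit_nat.
  by rewrite -(mul1m (end_monoid K A)) -compA -tensm_comp comp1m compm1.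
have m1r : m ∘ (idm ⊗₁ e) = runit U.
  have mrP := comonoid_hom_comp mP (comonoid_hom_tensor idP eP).
  apply: (universal_curry_cancel mrP (comonoid_hom_runit U)).
  rewrite compA mE -compA -tensm_comp eE compm1 -runit_nat.
  by rewrite -(mulm1 (end_monoid K A)) -compA -tensm_comp comp1m compm1.
by exists (MkMonoidOn mA m1l m1r).
Qed.

End Universal.

Theorem theorem4p9
  (C : BraidedCategory) (K : ClosedStructure C)
  (HC : ExtrEpiMono_structured C)
  (Omega : Type) (s t : Omega -> nat) (A : Magma C s t)
  (V : Submonoid (end_monoid K A))
  (U : Comonoid C) (psiU : Hom (U ⊗ A) A)
  (HU : is_universal_measuring V psiU) :
  exists (M : MonoidOn U) (HB : is_bimonoid M U),
    let BU := MkBimonoid HB in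
    (forall (B : Bimonoid C) (psi : Hom (B ⊗ A) A),
       is_action psi -> cosupp_submonoid_of V psi ->
       exists phi : Hom B U,
         unique (fun f : Hom B U =>
                   is_comonoid_hom (bim_comon B) U f /\
                   psiU ∘ (f ⊗₁ idm) = psi) phi /\
         is_bimonoid_hom (B := B) (B' := BU) phi) /\
    is_universal_acting V (U := BU) psiU.
Proof.
have [M [mP eP [kM k1]]] := universal_monoid_exists HU.
have HB : is_bimonoid M U by apply/is_bimonoidP.
have univ (B : Bimonoid C) (psi : Hom (B ⊗ A) A) :
    is_action psi -> factors_through (curry K psi) (incl V) ->
    exists phi : Hom B U,
      unique (fun f : Hom B U =>
                is_comonoid_hom (bim_comon B) U f /\
                psiU ∘ (f ⊗₁ idm) = psi) phi /\
      is_bimonoid_hom (B := B) (B' := MkBimonoid HB) phi.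
  move=> [psiM /(is_moduleP K) [psimul psione]] psiV.
  have [mB eB] := (is_bimonoidP _ _).1 (bim_law B).
  have [_ _ univ] := HU.
  have [phi [[phiP phiE] phi_uniq]] :=
    univ (MkComonoid (bim_comon B)) _ psiM psiV.
  have kphi : curry K psiU ∘ phi = curry K psi by rewrite curry_pullback phiE.
  exists phi; split=> //; split=> //; split=> /=.
    have phimP := comonoid_hom_comp mP (comonoid_hom_tensor phiP phiP).
    apply: (universal_curry_cancel HU (comonoid_hom_comp phiP mB) phimP).
    by rewrite !compA kphi psimul kM -compA -tensm_comp kphi.
  apply: (universal_curry_cancel HU (comonoid_hom_comp phiP eB) eP).
  by rewrite compA kphi psione k1.
exists M, HB; split.
  by move=> B psi psiP /cosupp_factors; exact: univ.
have [psiUm psiUV _] := HU; split=> //.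
  by split=> //; apply/(is_moduleP K).
move=> B psi psiP psiV.
have [phi [[[phiP phiE] phi_uniq] phiB]] := univ B psi psiP psiV.
by exists phi; split=> // f [[_ fP] fE]; apply: phi_uniq.
Qed.
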